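(* Let $q$ be a prime power and let $n,r\ge 1$ be integers. The number of $n$-restricted $q$-set partitions of $\{1,\ldots,r\}$ is $$|\mathcal{P}_{n\times r}(q)|=\sum_{\ell=1}^n S(r,\ell)\,[n][n-1]\cdots[n-\ell+1].$$
   Context: $[i]=\frac{q^i-1}{q-1}$ for integers $i\ge0$, and $S(r,\ell)$ is the Stirling number of the second kind (the number of set partitions of an $r$-element set into $\ell$ nonempty subsets). $\mathbb{Z}_n^r=\{(k_1,\ldots,k_r)\in\mathbb{Z}^r\mid 0\le k_1,\ldots,k_r\le n-1\}$. For $k\in\mathbb{Z}_n^r$ its $\ast$-height $k^*=(k_1^*,\ldots,k_r^* )$ is defined recursively by $k_1^*=0$ and, for $j\ge 2$, $k_j^*=\min\{k_j,\ \max\{k_1^*+1,k_2^*+1,\ldots,k_{j-1}^*+1\}\}$. The set of $n$-restricted $q$-set partitions of $\{1,\ldots,r\}$ is $$\mathcal{P}_{n\times r}(q)=\{((k_1,a^{(1)}),\ldots,(k_r,a^{(r)}))\mid (k_1,\ldots,k_r)\in\mathbb{Z}_n^r,\ a^{(j)}\in\mathbb{F}_q^{\,k_j-k_j^*}\},$$ where $\mathbb{F}_q$ is the field with $q$ elements. *)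

(* Defs.v *)
From mathcomp Require Import all_boot all_order all_algebra.
Set Implicit Arguments.
Unset Strict Implicit.
Unset Printing Implicit Defensive.
Import GRing.Theory.

(* Indices are 0-based: [k j] stands for k_{j+1}. *)

(* [star_heights k j] is the list k_1^*, ..., k_j^* of the first j heights,
   for a sequence k of which only the first j entries matter. *)
Fixpoint star_heights (k : nat -> nat) (j : nat) : seq nat :=
  if j is j'.+1 then
    let h := star_heights k j' in
    rcons h (if j' is 0 then 0 else minn (k j') (\max_(x <- h) x.+1))
  else [::].

Definition star_height (k : nat -> nat) (j : nat) : nat :=
  last 0 (star_heights k j.+1).

Lemma star_height0 (k : nat -> nat) : star_height k 0 = 0.
Proof. by []. Qed.

Lemma star_heightsE (k : nat -> nat) (j : nat) :
  star_heights k j = [seq star_height k i | i <- iota 0 j].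
Proof.
elim: j => [//|j IHj]; rewrite -addn1 iotaD map_cat -IHj cats1 addn1.
by rewrite /star_height /= last_rcons.
Qed.

Lemma star_heightS (k : nat -> nat) (j : nat) :
  star_height k j.+1 = minn (k j.+1) (\max_(i < j.+1) (star_height k i).+1).
Proof.
rewrite {1}/star_height; set s := star_heights _ _.
have -> : s = rcons (star_heights k j.+1)
  (minn (k j.+1) (\max_(x <- star_heights k j.+1) x.+1)) by [].
by rewrite last_rcons star_heightsE big_map -[iota _ _]/(index_iota 0 j.+1) big_mkord.
Qed.

(* The heights of k in Z_n^r; entries past r are padded with 0 and never
   influence the first r heights. *)
Definition height (n r : nat) (k : r.-tuple 'I_n) (j : 'I_r) : nat :=
  star_height (nth 0 [seq val x | x <- k]) j.

(* The pairs (k_j, a^(j)) are regrouped as (k, a): the tuple k together with a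
   family of row vectors, a^(j) having length k_j - k_j^*. *)
Definition qSetPartition (F : finFieldType) (n r : nat) : finType :=
  {k : r.-tuple 'I_n &
    {dffun forall j : 'I_r, 'rV[F]_(tnth k j - height k j)}}.

Definition stirling2 (r l : nat) : nat :=
  #|[set P : {set {set 'I_r}} | partition P [set: 'I_r] & #|P| == l]|.

Definition qint (q i : nat) : rat := ((q%:R ^+ i - 1) / (q%:R - 1))%R.

(* Main.v *)
Require Import Defs.
From mathcomp Require Import all_boot all_order all_algebra zify ring.

(* Let m be the maximum of k_i^* + 1 over the entries read so far (0 at the
   start). A next entry x < m has height x, so it contributes a factor 1 and
   leaves m unchanged: m choices. An entry x >= m has height m, contributes
   q^(x - m) and increases m by 1: total weight [n - m]. The weighted count of
   the words that bring m from 0 to l therefore obeys the Stirling recurrence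
   S(r+1, l+1) = S(r, l) + (l+1) S(r, l+1), twisted by the factors [n - i]. *)

Set Implicit Arguments.
Unset Strict Implicit.
Unset Printing Implicit Defensive.
Import GRing.Theory Num.Theory.

(** * Stirling recurrence for set partitions *)

Section Partitions.
Variable T : finType.
Implicit Types (x : T) (A B : {set T}) (P Q : {set {set T}}) (l : nat).

Definition partitions A l : {set {set {set T}}} :=
  [set P | partition P A & #|P| == l].

Lemma partition_sub P A B : partition P A -> B \in P -> B \subset A.
Proof. by case/and3P=> /eqP <- _ _ PB; apply: bigcup_sup. Qed.

Lemma card_partitionsU1 x A l : x \notin A ->
  #|partitions (x |: A) l.+1|
    = #|partitions A l| + l.+1 * #|partitions A l.+1|.
Proof.
move=> xA.
(* No block of a partition of [A] contains [x]; the union form covers both [[set x]] and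
   [x |: B]. *)
have notinP P B C : partition P A -> x \in B -> B :|: C \notin P.
  move=> PA xB; apply: contra xA => /(partition_sub PA)/subsetP; apply.
  by rewrite inE xB.
have set1N P : partition P A -> [set x] \notin P.
  by move=> PA; have := notinP P [set x] set0 PA (set11 x); rewrite setU0.
(* Split on whether x is alone in its block; if not, deleting x leaves a
   partition of A with a marked block. *)
rewrite -(cardsID [set P : {set {set T}} | [set x] \in P]); congr (_ + _).
  have -> : partitions (x |: A) l.+1 :&: [set P : {set {set T}} | [set x] \in P]
      = [set [set x] |: P | P in partitions A l].
    apply/setP=> P; rewrite !inE; apply/andP/imsetP => [[/andP[PA cP] Px]|].
      exists (P :\ [set x]); last by rewrite setD1K.
      rewrite inE -[A](setU1K xA) partitionD1 //=.
      by move: cP; rewrite (cardsD1 [set x]) Px.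
    case=> Q; rewrite inE => /andP[QA /eqP cQ] ->.
    rewrite setU11 cardsU1 set1N // cQ eqxx andbT; split=> //; apply: partitionU1 => //.
      by apply/set0Pn; exists x; rewrite inE.
    by rewrite disjoints1.
  rewrite card_in_imset // => P Q; rewrite !inE => /andP[PA _] /andP[QA _] E.
  by rewrite -(setU1K (set1N _ PA)) E setU1K ?set1N.
(* A partition with a marked block is sent to the one where [x] has joined that block; [f] is shown
   to be a bijection from [X]. *)
pose f (p : {set {set T}} * {set T}) := (x |: p.2) |: (p.1 :\ p.2).
pose X := [set p : {set {set T}} * {set T} |
             (p.1 \in partitions A l.+1) && (p.2 \in p.1)].
have -> : partitions (x |: A) l.+1 :\: [set P : {set {set T}} | [set x] \in P]
    = f @: X.
  apply/setP=> P; rewrite !inE; apply/and3P/imsetP => [[Px PA cP]|].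
    have xP : x \in cover P.
      by case/and3P: PA => /eqP -> _ _; rewrite setU11.
    have BP := pblock_mem xP; have xB : x \in pblock P x by rewrite mem_pblock.
    set B := pblock P x in BP xB.
    have Bx0 : B :\ x != set0.
      apply: contra Px => /eqP E.
      by rewrite -(_ : B = [set x]) // -(setD1K xB) E setU0.
    have PBA := partitionD1 PA BP.
    have E : A = (B :\ x) :|: ((x |: A) :\: B).
      apply/setP=> y; rewrite !inE; case: eqP => [->|yx] /=.
        by rewrite xB (negPf xA).
      case yB: (y \in B) => //=.
      have /subsetP/(_ y yB) := partition_sub PA BP.
      by rewrite !inE => /orP[/eqP|].
    have dis : [disjoint B :\ x & (x |: A) :\: B].
      rewrite -setI_eq0; apply/eqP/setP=> y; rewrite !inE.
      by case: (y \in B); rewrite ?andbF.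
    have Q1 := partitionU1 PBA Bx0 dis.
    (* [B :\ x] is nonempty and disjoint from the other blocks, so inserting it restores the number
       of blocks. *)
    have NB : B :\ x \notin P :\ B.
      apply/negP => /(partition_sub PBA) /subsetP sB.
      have [y yB] := set0Pn _ Bx0; have := sB y yB.
      by move: yB; rewrite !inE => /andP[_ ->].
    exists ((B :\ x) |: (P :\ B), B :\ x); last first.
      by rewrite /f /= setU1K // setD1K // setD1K.
    by rewrite !inE eqxx /= andbT {1}E Q1 cardsU1 NB -(eqP cP) (cardsD1 B P) BP eqxx.
  case=> -[Q B]; rewrite !inE /= => /andP[/andP[QA /eqP cQ] QB] ->.
  have sBA := partition_sub QA QB.
  have xB : x \notin B by apply: contra xA => /(subsetP sBA).
  have QBA := partitionD1 QA QB.
  rewrite /f /=; split.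
  - rewrite !inE negb_or; apply/andP; split; last first.
      by apply/negP => /andP[_]; apply/negP/set1N.
    have [y yB] := set0Pn _ (partition_neq0 QA QB).
    apply: contra xB => /eqP /setP/(_ y).
    by rewrite !inE yB orbT => /eqP <-.
  - have -> : x |: A = (x |: B) :|: (A :\: B).
      apply/setP=> y; rewrite !inE; have := subsetP sBA y.
      by case: (y \in B) => [->|]; rewrite ?orbT ?orbF.
    apply: partitionU1 => //; first by apply/set0Pn; exists x; rewrite setU11.
    rewrite -setI_eq0; apply/eqP/setP=> y; rewrite !inE.
    case: eqP => [->|_]; first by rewrite (negPf xA) andbF.
    by case: (y \in B).
  - rewrite cardsU1 -cQ (cardsD1 B Q) QB inE negb_and orbC.
    by rewrite notinP ?set11.
(* Injectivity: the only block of the image containing [x] is [x |: B], so the image determines [B],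
   and then the partition. *)
rewrite card_in_imset; last first.
  move=> [P B] [Q C]; rewrite !inE /= => /andP[/andP[PA _] PB].
  move=> /andP[/andP[QA _] QC] E.
  have N R D : x |: D \notin R :\ D -> R :\ D = f (R, D) :\ (x |: D).
    by move=> ?; rewrite /f setU1K.
  have NN R D D' : partition R A -> x |: D' \notin R :\ D.
    by move=> RA; rewrite inE negb_and orbC notinP ?set11.
  have EB : x |: B = x |: C.
    have : x |: B \in f (P, B) by rewrite setU11.
    rewrite E.
    by rewrite /f /= inE (negPf (NN _ _ _ QA)) orbF inE => /eqP.
  have xN R D : partition R A -> D \in R -> x \notin D.
    by move=> RA RD; apply: contra xA => /(subsetP (partition_sub RA RD)).
  have BC : B = C by rewrite -(setU1K (xN _ _ PA PB)) EB setU1K // (xN _ _ QA QC).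
  move: E QC; rewrite -BC => E QC.
  by rewrite -(setD1K PB) (N P B) ?NN // E -N ?NN // setD1K.
rewrite -sum1_card (eq_bigl (fun p => (p.1 \in partitions A l.+1) && (p.2 \in p.1)));
  last by move=> p; rewrite inE.
rewrite -(pair_big_dep _ (fun Q B => B \in Q) (fun _ _ => 1)) /= mulnC.
rewrite -sum_nat_const; apply: eq_bigr => Q; rewrite sum1_card => PQ.
by have : Q \in partitions A l.+1 by []; rewrite inE => /andP[_ /eqP].
Qed.

Fixpoint stirling2_rec (r l : nat) : nat :=
  match r, l with
  | 0, 0 => 1
  | r'.+1, l'.+1 => stirling2_rec r' l' + l * stirling2_rec r' l
  | _, _ => 0
  end.

Lemma card_partitions A l : #|partitions A l| = stirling2_rec #|A| l.
Proof.
have [m] := ubnP #|A|; elim: m A l => // m IHm A l.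
have [->|/set0Pn[x xA]] := eqVneq A set0.
  rewrite cards0 => _.
  have -> : partitions set0 l = if l is 0 then [set set0] else set0.
    apply/setP=> P; rewrite inE partition_set0.
    case: l => [|l]; rewrite !inE; last by apply/andP => -[/eqP ->]; rewrite cards0.
    by case: eqP => // ->; rewrite cards0.
  by case: l => [|l]; rewrite ?cards1 ?cards0.
rewrite (cardsD1 x) xA add1n ltnS => Am.
case: l => [|l] /=; last first.
  by rewrite -{1}(setD1K xA) card_partitionsU1 ?setD11 // !IHm.
(* A partition without blocks covers only the empty set. *)
apply/eqP; rewrite cards_eq0 -subset0; apply/subsetP=> P.
rewrite inE cards_eq0 => /andP[/and3P[/eqP + _ _] /eqP P0].
by rewrite P0 /cover big_set0 => A0; rewrite -A0 inE in xA.
Qed.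

End Partitions.

Lemma stirling2E r l : stirling2 r l = stirling2_rec r l.
Proof. by rewrite -[r in RHS]card_ord -cardsT -card_partitions. Qed.

(** * Words weighted by their heights *)

(* Number of vector families attached to k when the running maximum of the
   k_i^* + 1 has already reached m. *)
Fixpoint star_weight (q m : nat) (k : seq nat) : nat :=
  if k is x :: k' then
    q ^ (x - m) * star_weight q (if x < m then m else m.+1) k'
  else 1.

(** The free start [j] lets the induction on [d] advance it. With truncated subtraction, k - min(k,
    m) = k - m, and max(m, min(k, m) + 1) is m if k < m and m + 1 otherwise. *)
Lemma prod_star_height q k j d :
  \prod_(j <= i < j + d) q ^ (k i - star_height k i) =
    star_weight q (\max_(i < j) (star_height k i).+1) [seq k i | i <- iota j d].
Proof.
(* An empty maximum is 0, so the recursive formula also gives height 0 at index 0. *)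
have shE i : star_height k i = minn (k i) (\max_(i' < i) (star_height k i').+1).
  by case: i => [|i]; rewrite ?star_heightS // big_ord0 minn0.
elim: d j => [|d IHd] j; first by rewrite addn0 big_geq.
rewrite addnS big_ltn ?ltnS ?leq_addr // -addSn IHd /= big_ord_recr /= shE.
by case: ltnP => [lt|le]; congr (_ ^ _ * star_weight _ _ _); lia.
Qed.

Lemma card_qSetPartition (F : finFieldType) (n r : nat) :
  #|qSetPartition F n r| =
    \sum_(k : r.-tuple 'I_n) star_weight #|F| 0 [seq val x | x <- k].
Proof.
rewrite card_tagged sumnE big_map big_enum; apply: eq_bigr => k _.
rewrite card_dep_ffun foldrE big_map big_enum.
set s := [seq val x | x <- k].
have sr : size s = r by rewrite size_map size_tuple.
have := prod_star_height #|F| (nth 0 s) 0 r.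
rewrite big_ord0 -[map _ _]/(mkseq (nth 0 s) r) -[in mkseq _ _]sr mkseq_nth => <-.
rewrite big_mkord; apply: eq_bigr => j _.
rewrite card_mx mul1n /height (tnth_nth (tnth k j)) -/s.
by rewrite (nth_map (tnth k j)) ?size_tuple.
Qed.

(** The q-integer [j], kept in [nat] without division. *)
Definition geom_sum (q j : nat) : nat := \sum_(i < j) q ^ i.

Definition total_star_weight (q n r m : nat) : nat :=
  \sum_(k : r.-tuple 'I_n) star_weight q m [seq val x | x <- k].

Lemma total_star_weightS q n r m : m <= n ->
  total_star_weight q n r.+1 m =
    m * total_star_weight q n r m + geom_sum q (n - m) * total_star_weight q n r m.+1.
Proof.
move=> mn; rewrite /total_star_weight.
rewrite (reindex (fun p : 'I_n * r.-tuple 'I_n => [tuple of p.1 :: p.2])) /=; last first.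
  exists (fun t => (thead t, [tuple of behead t])) => [[x t]|t] _ /=.
    by congr pair; apply: val_inj.
  by rewrite [RHS]tuple_eta.
rewrite -(pair_big xpredT xpredT (fun (x : 'I_n) (k : r.-tuple 'I_n) => q ^ (x - m) *
  star_weight q (if x < m then m else m.+1) [seq val y | y <- k])) /=.
under eq_bigr do rewrite -big_distrr /=.
rewrite -(big_mkord xpredT (fun x => q ^ (x - m) *
  \sum_(k : r.-tuple 'I_n) star_weight q (if x < m then m else m.+1) [seq val y | y <- k])).
(* For first entries below [m] the truncated exponent is 0; the others, shifted by [m], form a
   geometric sum. *)
rewrite (big_cat_nat (n := m)) //=; congr (_ + _).
  rewrite (eq_big_nat _ _ (F2 := fun=> total_star_weight q n r m)).
    by rewrite sum_nat_const_nat subn0.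
  by move=> i /andP[_ im]; rewrite im (eqP (ltnW im)) mul1n.
rewrite -{1}[m]add0n big_addn big_mkord big_distrl /=; apply: eq_bigr => i _.
by rewrite addnK ltnNge leq_addl.
Qed.

(** Words are grouped by the maximum [l] reached after [d] entries. The free length [r] of the
    unread part lets the induction on [d] read one more entry. *)
Lemma total_star_weight_stirling q n r d :
  total_star_weight q n (r + d) 0 =
    \sum_(l < n.+1) stirling2_rec d l * \prod_(i < l) geom_sum q (n - i)
       * total_star_weight q n r l.
Proof.
elim: d r => [|d IHd] r.
  rewrite addn0 big_ord_recl [X in _ + X]big1 => [|l _]; last by rewrite mul0n.
  by rewrite big_ord0 /= addn0 !mul1n.
rewrite addnS -addSn IHd.
under eq_bigr => l _ do rewrite total_star_weightS -1?ltnS // mulnDr.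
rewrite big_split /= big_ord_recl /= mul0n muln0 add0n.
(* As [0] = 0, the maximum cannot grow past [n]; the top term drops and both sums run over the new
   maxima 1 to [n]. *)
have g0 : geom_sum q 0 = 0 by rewrite /geom_sum big_ord0.
rewrite [X in _ + X]big_ord_recr /= subnn g0 mul0n muln0 addn0.
rewrite [RHS]big_ord_recl /= !mul0n add0n -big_split; apply: eq_bigr => l _ /=.
rewrite /bump /= add1n big_ord_recr /=; ring.
Qed.

(** * Passage to rational numbers *)

Local Open Scope ring_scope.

Lemma qint_geom_sum q j : (1 < q)%N -> qint q j = (geom_sum q j)%:R.
Proof.
move=> q1; have q10 : q%:R - 1 != 0 :> rat by rewrite subr_eq0 pnatr_eq1 gtn_eqF.
rewrite /qint GRing.subrX1 mulrC mulKf // natr_sum.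
by apply: eq_bigr => i _; rewrite natrX.
Qed.

Theorem mainTheorem2 (q : nat)
    (hq : exists p m : nat, [/\ prime p, (0 < m)%N & q = (p ^ m)%N])
    (F : finFieldType) (hF : #|F| = q)
    (n r : nat) (hn : (1 <= n)%N) (hr : (1 <= r)%N) :
  (#|qSetPartition F n r|)%:R =
    \sum_(1 <= l < n.+1)
       (stirling2 r l)%:R * \prod_(i < l) qint q (n - i) :> rat.
Proof.
have q1 : (1 < q)%N by rewrite -hF card_finNzRing_gt1.
rewrite card_qSetPartition hF -[\sum_k _]/(total_star_weight q n (0 + r) 0).
rewrite total_star_weight_stirling natr_sum.
rewrite -(big_mkord xpredT (fun l => (stirling2_rec r l * \prod_(i < l) geom_sum q (n - i)
       * total_star_weight q n 0 l)%:R)) big_ltn //.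
(* The term [l = 0] vanishes because S(r, 0) = 0 for r >= 1. *)
rewrite -{1}(prednK hr) /= !mul0n add0r; apply: eq_bigr => l _.
(* All entries are read: only the empty word remains, of weight 1. *)
rewrite /total_star_weight (big_pred1 [tuple]); last by move=> t; apply/esym/eqP/tuple0.
rewrite muln1 natrM stirling2E natr_prod; congr (_ * _).
by apply: eq_bigr => i _; rewrite qint_geom_sum.
Qed.
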